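(* Let $(\Omega,\mathcal F,(\mathcal F_t)_{t\ge 0},Q)$ be a filtered probability space satisfying the usual conditions and supporting a Brownian motion, with $\mathcal F_0$ trivial; $\mathbf E$ denotes expectation under $Q$. Let $\sigma>0$ and $z_0$ be constants, and let $(S_t)$ and $(\theta_t)$ be two real-valued adapted processes such that $\theta_0=\sigma$, $S_0=z_0$, and $S_t$ is strictly positive. Assume that there exist three equidistant times $0\le T_1<T_2<T_3$ (that is, $T_2-T_1=T_3-T_2$) such that for each $i\in\{1,2,3\}$, all $K\in\mathbb R$ and all $0\le t\le T_i$, $$\mathbf E[(S_{T_i}-K)^+\mid\mathcal F_t]=C(T_i,t,K,\theta_t,S_t)\quad\text{almost surely},$$ where $C$ is the Black-Scholes call price function (with zero interest rate). Then for all $0\le t\le T_1$, $\theta_t^2=\sigma^2$ almost surely.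
   Context: For a constant $\sigma$, let $Z$ be the solution of $dZ_t=\sigma Z_t\,dB_t$, $Z_0=z_0$, with $B$ a Brownian motion. The Black-Scholes call price function is $C(T,t,K,\sigma,z)=\mathbf E[(Z_T-K)^+\mid Z_t=z]$ for $0\le t\le T$, $K\in\mathbb R$, $z>0$; explicitly, $C(T,t,K,\sigma,z)=\mathbf E\big[\big(z\,e^{\sigma\sqrt{T-t}\,N-\frac12\sigma^2(T-t)}-K\big)^+\big]$ with $N$ a standard normal random variable. The same formula is used for every real value of $\sigma$, and $C(T_i,t,K,\theta_t,S_t)$ means this deterministic function evaluated at $\sigma=\theta_t$, $z=S_t$. Notation: $x^+=\max(x,0)$. *)

(* Defs.v *)
From HB Require Import structures.
From mathcomp Require Import all_boot all_order all_algebra.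
From mathcomp Require Import all_classical all_reals all_analysis.
From mathcomp Require Import measurable_realfun.

Set Implicit Arguments.
Unset Strict Implicit.
Unset Printing Implicit Defensive.

Import Order.TTheory GRing.Theory Num.Theory.
Import numFieldNormedType.Exports.

Local Open Scope classical_set_scope.
Local Open Scope ring_scope.

(* Processes and filtrations are indexed by all of R; only their values at
   times t >= 0 are ever constrained or used. *)

Definition pos_part (R : realType) (x : R) : R := Num.max x 0.

(* Extended-real valued so that the defining integral, which is that of a
   nonnegative function, needs no integrability side condition. *)
Definition bs_call (R : realType) (T t K sigma z : R) : \bar R :=
  ('E_(normal_prob (0 : R) 1)
     [fun x : R => pos_part
        (z * expR (sigma * Num.sqrt (T - t) * x - sigma ^+ 2 * (T - t) / 2)
         - K)])%E.

(* When G is a sigma-algebra, the measurable sets of g_sigma_algebraType G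
   are exactly the members of G. *)
Definition measurable_wrt (W : pointedType) (d : measure_display)
    (E : measurableType d) (G : set (set W)) (X : W -> E) : Prop :=
  measurable_fun [set: g_sigma_algebraType G]
    (X : g_sigma_algebraType G -> E).

Definition filtration (d : measure_display) (W : measurableType d)
    (R : realType) (F : R -> set (set W)) : Prop :=
  [/\ (forall t : R, 0 <= t -> sigma_algebra [set: W] (F t)),
      (forall t : R, 0 <= t -> F t `<=` measurable) &
      (forall s t : R, 0 <= s -> s <= t -> F s `<=` F t)].

Definition usual_conditions (d : measure_display) (W : measurableType d)
    (R : realType) (Q : probability W R) (F : R -> set (set W)) : Prop :=
  [/\ measure_is_complete Q,
      (forall N : set W, Q.-negligible N -> F 0 N) &
      (forall t : R, 0 <= t -> \bigcap_(s in [set s | t < s]) F s = F t)].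

Definition trivial_sigma_algebra (d : measure_display) (W : measurableType d)
    (R : realType) (Q : probability W R) (G : set (set W)) : Prop :=
  forall A : set W, G A -> Q A = 0%E \/ Q A = 1%E.

Definition adapted (W : pointedType) (R : realType)
    (F : R -> set (set W)) (X : R -> W -> R) : Prop :=
  forall t : R, 0 <= t -> measurable_wrt (F t) (X t).

(* The second argument of normal_prob is the standard deviation. *)
Definition brownian_motion (d : measure_display) (W : measurableType d)
    (R : realType) (Q : probability W R) (F : R -> set (set W))
    (B : R -> W -> R) : Prop :=
  [/\ adapted F B,
      {ae Q, forall w, B 0 w = 0},
      (forall s t : R, 0 <= s -> s < t ->
         forall U : set R, measurable U ->
           Q ((B t \- B s) @^-1` U) = normal_prob 0 (Num.sqrt (t - s)) U),
      (forall s t : R, 0 <= s -> s < t ->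
         forall (A : set W) (U : set R), F s A -> measurable U ->
           Q (A `&` (B t \- B s) @^-1` U) =
           (Q A * Q ((B t \- B s)%R @^-1` U))%E) &
      {ae Q, forall w, {within [set t : R | 0 <= t],
                          continuous (fun t => B t w)}}].

(* Y is a version of E[X | G], for a nonnegative random variable X: the
   conditional expectation in the [0, +oo]-valued sense, which always exists
   and agrees with the usual one when X is integrable. *)
Definition is_condexp_ge0 (d : measure_display) (W : measurableType d)
    (R : realType) (Q : probability W R) (G : set (set W))
    (X : W -> R) (Y : W -> \bar R) : Prop :=
  [/\ measurable_wrt G Y,
      (forall w, (0 <= Y w)%E) &
      (forall A : set W, G A ->
         (\int[Q]_(w in A) Y w = \int[Q]_(w in A) (X w)%:E)%E)].

(* Main.v *)
Require Import Defs.
From HB Require Import structures.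
From mathcomp Require Import all_boot all_order all_algebra.
From mathcomp Require Import all_classical all_reals all_analysis.
From mathcomp Require Import measurable_realfun.
From mathcomp Require Import ring lra.

Import Order.TTheory GRing.Theory Num.Theory.
Import numFieldNormedType.Exports.

Local Open Scope classical_set_scope.
Local Open Scope ring_scope.

(** The call prices of an asset determine its second moment, because
    integrating the payoff (y - K)^+ over the strikes K >= 0 gives (y^+)^2 / 2.
    Hence the pricing hypothesis, through Tonelli's theorem and the Gaussian
    integral of exp (a x), becomes a second-moment identity
    ([bs_second_moment]): for t <= T1 and T one of the three maturities,
<<
      E[S_T^2] = E[S_t^2 exp (theta_t^2 (T - t))].
>>
    At time 0 the right-hand side is the constant z0^2 exp (sigma^2 T).  Write
    h for the common gap between the maturities, and set
<<
      X = S_t^2 exp (theta_t^2 (T1 - t)) / 2,   U = exp (theta_t^2 h),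
      a = z0^2 exp (sigma^2 T1) / 2,            u = exp (sigma^2 h).
>>
    Comparing the identity at times t and 0 for the three maturities T1,
    T1 + h and T1 + 2 h yields E[X] = a, E[X U] = a u and E[X U^2] = a u^2:
    under the probability of density X / a, the variable U has mean u and
    variance 0.  So U = u almost surely ([ae_eq_of_geometric_moments]), that is
    theta_t^2 = sigma^2.  Three equidistant maturities are exactly what gives
    access to the first two moments of U. *)

(** * Call prices determine the second moment *)

Lemma pos_part_ge0 (R : realType) (x : R) : 0 <= pos_part x.
Proof. by rewrite /pos_part le_max lexx orbT. Qed.

Lemma pos_partMr (R : realType) (x y : R) : 0 <= y ->
  pos_part (x * y) = pos_part x * y.
Proof. by move=> y0; rewrite /pos_part maxr_pMl// mul0r. Qed.

Lemma measurable_pos_part (R : realType) (d : measure_display)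
    (W : measurableType d) (f : W -> R) :
  measurable_fun setT f -> measurable_fun setT (fun w => pos_part (f w)).
Proof. by move=> mf; apply: measurable_maxr => //; exact: measurable_cst. Qed.

(** For y > 0 the integrand vanishes beyond K = y, and the rest is a quadratic
    antiderivative.  For y <= 0 no nonnegative strike pays, which is why the
    positive part appears on the right. *)
Lemma integral_call_strikes (R : realType) (y : R) :
  (\int[lebesgue_measure]_(K in `[0%R, +oo[) (pos_part (y - K))%:E =
   (pos_part y ^+ 2 / 2)%:E)%E.
Proof.
have [y0|y0] := leP y 0.
  rewrite {2}/pos_part (max_r y0) expr0n/= mul0r.
  under eq_integral => K.
    rewrite inE/= in_itv/= andbT => K0.
    rewrite /pos_part (max_r (_ : y - K <= 0)); last by lra.
    over.
  by rewrite integral0.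
transitivity (\int[lebesgue_measure]_(K in `[0%R, y]) (y - K)%:E)%E.
  rewrite integral_mkcond [RHS]integral_mkcond; apply: eq_integral => K _.
  rewrite !patchE !mem_setE !in_itv/= andbT.
  have [K0|K0]//= := leP 0 K.
  have [Ky|Ky] := leP K y; rewrite /pos_part.
    by rewrite max_l//; lra.
  by rewrite max_r//; lra.
pose F (K : R) := - ((y - K) ^+ 2 / 2).
have dF (K : R) : is_derive K 1 F (y - K).
  rewrite /F; apply: is_derive_eq.
  by rewrite /GRing.scale/=; lra.
rewrite (@continuous_FTC2 _ (fun K => y - K) F)//.
- by rewrite -EFinB /F /pos_part (max_l (ltW y0)); congr EFin; lra.
- apply: continuous_subspaceT => K.
  by apply: cvgB; [exact: cvg_cst|exact: cvg_id].
- have cF : continuous F.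
    move=> K; apply: differentiable_continuous.
    by apply/derivable1_diffP; apply: ex_derive.
  split=> [K _| |]; first exact: ex_derive.
  + exact/cvg_at_right_filter/cF.
  + exact/cvg_at_left_filter/cF.
- by move=> K _; rewrite derive1E derive_val.
Qed.

(** The mechanism of the whole proof: by Tonelli's theorem, the function of K
    that gives the expected call payoff determines the expectation of the
    squared positive part.  It is used both for the asset at maturity and for
    the Black-Scholes lognormal variable. *)
Lemma integral_calls (R : realType) (d : measure_display)
    (W : measurableType d) (mu : {sigma_finite_measure set W -> \bar R})
    (X : W -> R) : measurable_fun setT X ->
  (\int[lebesgue_measure]_(K in `[0%R, +oo[)
      \int[mu]_w (pos_part (X w - K))%:E =
   \int[mu]_w (pos_part (X w) ^+ 2 / 2)%:E)%E.
Proof.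
move=> mX.
pose f (p : R * W) : \bar R :=
  (\1_(`[0%R, +oo[ : set R) p.1 * pos_part (X p.2 - p.1))%:E.
have mf : measurable_fun setT f.
  apply/measurable_EFinP; apply: measurable_funM.
    apply: (@measurableT_comp _ _ _ _ _ _ (\1_(`[0%R, +oo[ : set R) : R -> R) _ fst) => //.
  apply: measurable_pos_part; apply: measurable_funB => //.
  by apply: measurableT_comp => //; exact: mX.
have f0 p : (0 <= f p)%E by rewrite lee_fin mulr_ge0// pos_part_ge0.
transitivity (\int[lebesgue_measure]_K \int[mu]_w f (K, w))%E.
  rewrite integral_mkcond; apply: eq_integral => K _.
  rewrite patchE /f/= indicE; case: ifPn => K0; rewrite ?K0 ?(negbTE K0).
    by apply: eq_integral => w _; rewrite mul1r.
  by rewrite integral0_eq// => w _; rewrite mul0r.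
rewrite fubini_tonelli//; apply: eq_integral => w _.
rewrite -integral_call_strikes [RHS]integral_mkcond; apply: eq_integral => K _.
by rewrite patchE /f/= indicE; case: ifPn => K0; rewrite ?K0 ?(negbTE K0) ?mul1r ?mul0r.
Qed.

(** * The Gaussian integral *)

(** The Radon-Nikodym derivative of a normal law is only determined almost
    everywhere, so it has to be identified with the explicit density.
    Nonnegativity of f replaces any integrability condition. *)
Lemma ge0_integral_normal_prob (R : realType) (m s : R) (f : R -> \bar R) :
  measurable_fun setT f -> (forall x, 0 <= f x)%E ->
  (\int[normal_prob m s]_x f x =
   \int[lebesgue_measure]_x (f x * (normal_pdf m s x)%:E))%E.
Proof.
move=> mf f0.
have dom := @normal_prob_dominates R m s.
rewrite -(Radon_Nikodym_SigmaFinite.change_of_variables dom)//.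
have iRN := Radon_Nikodym_SigmaFinite.f_integrable dom.
apply: ae_eq_integral => //.
- by apply: emeasurable_funM => //; exact: measurable_int iRN.
- apply: emeasurable_funM => //; apply/measurable_EFinP.
  exact: measurable_normal_pdf.
- apply: ae_eqe_mul2l; apply: integral_ae_eq => //.
    by apply/measurable_EFinP; exact: measurable_normal_pdf.
  by move=> E _ mE; rewrite -(Radon_Nikodym_SigmaFinite.f_integral dom).
Qed.

(** Completing the square turns exp (a x) times the standard density into
    exp (a^2 / 2) times the normal density of mean a, whose integral is 1. *)
Lemma normal_mgf (R : realType) (a : R) :
  (\int[normal_prob 0 1]_x (expR (a * x))%:E = (expR (a ^+ 2 / 2))%:E)%E.
Proof.
rewrite ge0_integral_normal_prob//; last first.
  by apply/measurable_EFinP; apply: measurableT_comp.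
transitivity
  (\int[lebesgue_measure]_x ((expR (a ^+ 2 / 2))%:E * (normal_pdf a 1 x)%:E))%E.
  apply: eq_integral => x _; rewrite -!EFinM; congr EFin.
  rewrite !normal_pdfE ?oner_eq0// mulrCA [RHS]mulrCA /normal_fun -!expRD.
  congr (_ * expR _); by field.
rewrite ge0_integralZl_EFin//.
- by rewrite integral_normal_pdf mule1.
- by move=> x _; rewrite lee_fin normal_pdf_ge0.
- by apply/measurable_EFinP; exact: measurable_normal_pdf.
Qed.

(** * Second moments in the Black-Scholes model *)

(** The asset price after a duration tau, started at s with volatility v, when
    the normalized Brownian increment equals x. *)
Definition bs_terminal {R : realType} (tau s v x : R) : R :=
  s * expR (v * Num.sqrt tau * x - v ^+ 2 * tau / 2).

Lemma bs_callE (R : realType) (T t K s v : R) :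
  bs_call T t K v s =
  (\int[normal_prob 0 1]_x (pos_part (bs_terminal (T - t) s v x - K))%:E)%E.
Proof. by rewrite /bs_call unlock. Qed.

(** Squaring doubles the exponent, so the Gaussian factor contributes
    exp (2 v^2 tau) and the drift exp (- v^2 tau). *)
Lemma integral_bs_terminal_sqr (R : realType) (tau s v : R) : 0 <= tau ->
  (\int[normal_prob 0 1]_x (pos_part (bs_terminal tau s v x) ^+ 2 / 2)%:E =
   (pos_part s ^+ 2 / 2 * expR (v ^+ 2 * tau))%:E)%E.
Proof.
move=> tau0.
transitivity (\int[normal_prob 0 1]_x
  ((pos_part s ^+ 2 / 2 * expR (- (v ^+ 2 * tau)))%:E *
   (expR ((2 * v * Num.sqrt tau) * x))%:E))%E.
  apply: eq_integral => x _; rewrite -EFinM; congr EFin.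
  rewrite pos_partMr ?expR_ge0// exprMn -expRM_natl mulrAC -[RHS]mulrA -expRD.
  by congr (_ * expR _); field.
rewrite ge0_integralZl_EFin//.
- rewrite normal_mgf -EFinM; congr EFin; rewrite -[LHS]mulrA -expRD.
  congr (_ * expR _).
  by rewrite !exprMn sqr_sqrtr//; field.
- by apply/measurable_EFinP; apply: measurableT_comp.
- by rewrite mulr_ge0 ?expR_ge0// divr_ge0// sqr_ge0.
Qed.

Lemma measurable_bs_terminal (R : realType) (d : measure_display)
    (W : measurableType d) (tau : R) (S theta : W -> R) :
  measurable_fun setT S -> measurable_fun setT theta ->
  measurable_fun setT
    (fun p : W * R => bs_terminal tau (S p.1) (theta p.1) p.2).
Proof.
move=> mS mtheta.
have mS1 : measurable_fun setT (fun p : W * R => S p.1).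
  exact: measurableT_comp.
have mt1 : measurable_fun setT (fun p : W * R => theta p.1).
  exact: measurableT_comp.
apply: measurable_funM => //; apply: measurableT_comp => //.
apply: measurable_funB; apply: measurable_funM => //.
- exact: measurable_funM.
- by apply: measurable_funM => //; exact: measurable_funX.
Qed.

(** The expected Black-Scholes price is itself an expected call payoff, namely
    that of the lognormal variable driven by an independent normal one on the
    product space; [integral_calls] then applies on both sides. *)
Lemma bs_second_moment (R : realType) (d : measure_display)
    (W : measurableType d) (Q : probability W R) (T t : R) (X S theta : W -> R) :
  measurable_fun setT X -> measurable_fun setT S ->
  measurable_fun setT theta -> t <= T ->
  (forall K : R, \int[Q]_w (pos_part (X w - K))%:E =
                 \int[Q]_w bs_call T t K (theta w) (S w))%E ->
  (\int[Q]_w (pos_part (X w) ^+ 2 / 2)%:E =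
   \int[Q]_w (pos_part (S w) ^+ 2 / 2 * expR (theta w ^+ 2 * (T - t)))%:E)%E.
Proof.
move=> mX mS mtheta tT eqK; have tau0 : 0 <= T - t by rewrite subr_ge0.
pose Z (p : W * R) := bs_terminal (T - t) (S p.1) (theta p.1) p.2.
have mZ : measurable_fun setT Z by exact: measurable_bs_terminal.
(* The product is taken through [product_subprobability] so that it
   carries the sigma-finite structure that [integral_calls] asks for. *)
pose mu := product_subprobability
  (Q : subprobability _ R, normal_prob 0 1 : subprobability _ R).
have iteratedE (f : W * R -> \bar R) :
    measurable_fun setT f -> (forall p, 0 <= f p)%E ->
    (\int[mu]_p f p = \int[Q]_w \int[normal_prob 0 1]_x f (w, x))%E.
  by move=> mf f0; exact: (@fubini_tonelli1 _ _ _ _ _ Q (normal_prob 0 1) f mf f0).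
rewrite -(integral_calls _ _ _ Q X mX).
transitivity (\int[mu]_p (pos_part (Z p) ^+ 2 / 2)%:E)%E.
  rewrite -(integral_calls _ _ _ mu Z mZ); apply: eq_integral => K _.
  rewrite eqK iteratedE.
  - by apply: eq_integral => w _; rewrite bs_callE.
  - apply/measurable_EFinP; apply: measurable_pos_part.
    exact: measurable_funB.
  - by move=> p; rewrite lee_fin pos_part_ge0.
rewrite iteratedE.
- by apply: eq_integral => w _; rewrite -integral_bs_terminal_sqr.
- apply/measurable_EFinP; apply: measurable_funM => //.
  by apply: measurable_funX; exact: measurable_pos_part.
- by move=> p; rewrite lee_fin divr_ge0// sqr_ge0.
Qed.

(** * Conditional expectations and the variance argument *)

Lemma measurable_wrt_measurable (d d' : measure_display)
    (W : measurableType d) (E : measurableType d') (G : set (set W))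
    (X : W -> E) : sigma_algebra setT G -> G `<=` measurable ->
  measurable_wrt G X -> measurable_fun setT X.
Proof.
move=> sG Gm mX _ B mB; have := mX measurableT B mB.
by rewrite /measurable/= sigma_algebra_id//; exact: Gm.
Qed.

Lemma condexp_ge0_expectation (R : realType) (d : measure_display)
    (W : measurableType d) (Q : probability W R) (G : set (set W))
    (X : W -> R) (Y Y' : W -> \bar R) :
  sigma_algebra setT G -> G `<=` measurable ->
  is_condexp_ge0 Q G X Y -> measurable_fun setT Y' ->
  {ae Q, forall w, Y w = Y' w} ->
  (\int[Q]_w (X w)%:E = \int[Q]_w Y' w)%E.
Proof.
move=> sG Gm [mY _ eqY] mY' YY'.
rewrite -eqY; last first.
  have [G0 GC _] := sG; by rewrite -(setD0 setT); exact: GC.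
apply: ae_eq_integral => //; first exact: measurable_wrt_measurable mY.
by apply: filterS YY' => w ->.
Qed.

(** The moments a, a u, a u^2 of U against X say that E[X (U - u)^2] = 0.  In
    extended reals the expansion of the square is written without subtraction,
    as X (U - u)^2 + 2 u (X U) = X U^2 + u^2 X. *)
Lemma ae_eq_of_geometric_moments (R : realType) (d : measure_display)
    (W : measurableType d) (Q : {measure set W -> \bar R}) (X U : W -> R)
    (a u : R) :
  measurable_fun setT X -> measurable_fun setT U ->
  (forall w, 0 <= X w) -> (forall w, 0 <= U w) -> 0 <= u ->
  (\int[Q]_w (X w)%:E = a%:E)%E ->
  (\int[Q]_w (X w * U w)%:E = (a * u)%:E)%E ->
  (\int[Q]_w (X w * U w ^+ 2)%:E = (a * u ^+ 2)%:E)%E ->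
  {ae Q, forall w, 0 < X w -> U w = u}.
Proof.
move=> mX mU X0 U0 u0 m0 m1 m2.
have mXU : measurable_fun setT (fun w => X w * U w) by exact: measurable_funM.
have mXU2 : measurable_fun setT (fun w => X w * U w ^+ 2).
  by apply: measurable_funM => //; exact: measurable_funX.
have mV : measurable_fun setT (fun w => X w * (U w - u) ^+ 2).
  apply: measurable_funM => //; apply: measurable_funX.
  exact: measurable_funB.
have V0 w : 0 <= X w * (U w - u) ^+ 2 by rewrite mulr_ge0// sqr_ge0.
have XU0 w : 0 <= X w * U w by rewrite mulr_ge0.
have XU20 w : 0 <= X w * U w ^+ 2 by rewrite mulr_ge0// sqr_ge0.
have u2 : 0 <= 2 * u by rewrite mulr_ge0.
have u20 : 0 <= u ^+ 2 by exact: sqr_ge0.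
have : (\int[Q]_w ((X w * (U w - u) ^+ 2)%:E + (2 * u)%:E * (X w * U w)%:E) =
        \int[Q]_w ((X w * U w ^+ 2)%:E + (u ^+ 2)%:E * (X w)%:E))%E.
  apply: eq_integral => w _; rewrite -!EFinM -!EFinD; congr EFin; ring.
have mE (f : W -> R) : measurable_fun setT f ->
  measurable_fun setT (fun w => (f w)%:E) by move=> ?; exact/measurable_EFinP.
have mEZ (k : R) (f : W -> R) : measurable_fun setT f ->
    measurable_fun setT (fun w => k%:E * (f w)%:E)%E.
  by move=> mf; apply: emeasurable_funM => //; exact: mE.
rewrite !ge0_integralD//; try by [exact: mE|exact: mEZ];
  try by move=> w _; rewrite -?EFinM lee_fin ?V0 ?mulr_ge0.
rewrite !ge0_integralZl_EFin//; try exact: mE; try by move=> w _; rewrite lee_fin.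
rewrite m0 m1 m2 -!EFinM -EFinD => eqV.
have V_eq0 : (\int[Q]_w (X w * (U w - u) ^+ 2)%:E = 0)%E.
  move: eqV; case: (integral _ _ _) => [r| |]// [] eqr.
  by congr EFin; move: eqr; lra.
have /ae_eq_integral_abs : (\int[Q]_w `|(X w * (U w - u) ^+ 2)%:E| = 0)%E.
  by rewrite -V_eq0; apply: eq_integral => w _; rewrite gee0_abs// lee_fin.
move=> /(_ measurableT (mE _ mV)); apply: filterS => w /(_ I) /= [] /eqP.
rewrite mulf_eq0 sqrf_eq0 subr_eq0 => /orP[/eqP ->|/eqP ->//].
by rewrite ltxx.
Qed.

Theorem theorem1 (R : realType) (d : measure_display) (W : measurableType d)
    (Q : probability W R) (F : R -> set (set W))
    (hF : filtration F) (hUsual : usual_conditions Q F)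
    (hB : exists B : R -> W -> R, brownian_motion Q F B)
    (hF0 : trivial_sigma_algebra Q (F 0))
    (sigma z0 : R) (hsigma : 0 < sigma)
    (S theta : R -> W -> R)
    (hS : adapted F S) (htheta : adapted F theta)
    (htheta0 : {ae Q, forall w, theta 0 w = sigma})
    (hS0 : {ae Q, forall w, S 0 w = z0})
    (hSpos : forall t : R, 0 <= t -> {ae Q, forall w, 0 < S t w})
    (T1 T2 T3 : R) (hT1 : 0 <= T1) (hT12 : T1 < T2) (hT23 : T2 < T3)
    (hT : T2 - T1 = T3 - T2)
    (hcall : forall T : R, T \in [:: T1; T2; T3] ->
       forall K t : R, 0 <= t -> t <= T ->
       exists Y : W -> \bar R,
         is_condexp_ge0 Q (F t) (fun w => pos_part (S T w - K)) Y /\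
         {ae Q, forall w, Y w = bs_call T t K (theta t w) (S t w)}) :
  forall t : R, 0 <= t -> t <= T1 -> {ae Q, forall w, theta t w ^+ 2 = sigma ^+ 2}.
Proof.
move=> t t0 tT1.
have [Fsig Fsub _] := hF.
have measF (X : R -> W -> R) (r : R) :
    adapted F X -> 0 <= r -> measurable_fun setT (X r).
  move=> aX r0; apply: measurable_wrt_measurable (aX r r0); first exact: Fsig.
  exact: Fsub.
have second_moment (T r : R) : T \in [:: T1; T2; T3] -> 0 <= r -> r <= T1 ->
  (\int[Q]_w (pos_part (S T w) ^+ 2 / 2)%:E =
   \int[Q]_w (pos_part (S r w) ^+ 2 / 2 *
               expR (theta r w ^+ 2 * (T - r)))%:E)%E.
  move=> Tin r0 rT1.
  have rT : r <= T.
    by move: Tin; rewrite !inE => /or3P[] /eqP ->; lra.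
  apply: bs_second_moment => //; try by apply: measF => //; lra.
  move=> K; have [Y [cY aeY]] := hcall T Tin K r r0 rT.
  apply: condexp_ge0_expectation cY _ aeY; [exact: Fsig|exact: Fsub|].
  have -> : (fun w => bs_call T r K (theta r w) (S r w)) =
      fubini_F (normal_prob 0 1) (fun p : W * R =>
        (pos_part (bs_terminal (T - r) (S r p.1) (theta r p.1) p.2 - K))%:E).
    by apply/funext => w; rewrite bs_callE.
  apply: measurable_fun_fubini_tonelli_F.
    apply/measurable_EFinP/measurable_pos_part/measurable_funB => //.
    by apply: measurable_bs_terminal; exact: measF.
  by move=> p; rewrite lee_fin pos_part_ge0.
pose V w := theta t w ^+ 2.
pose X w := pos_part (S t w) ^+ 2 / 2 * expR (V w * (T1 - t)).
pose h := T2 - T1.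
have moment (T : R) : T \in [:: T1; T2; T3] ->
    (\int[Q]_w (pos_part (S t w) ^+ 2 / 2 * expR (V w * (T - t)))%:E =
     (pos_part z0 ^+ 2 / 2 * expR (sigma ^+ 2 * T))%:E)%E.
  move=> Tin; rewrite -second_moment// (second_moment T 0)//.
  rewrite -[RHS]mule1 -(probability_setT Q) -integral_cst//.
  apply: ae_eq_integral => //.
  - apply/measurable_EFinP; apply: measurable_funM.
      apply: measurable_funM => //; apply: measurable_funX.
      by apply: measurable_pos_part; exact: measF.
    apply: measurableT_comp => //; apply: measurable_funM => //.
    by apply: measurable_funX; exact: measF.
  - by apply: filterS2 htheta0 hS0 => w -> -> _; rewrite subr0.
(* T2 = T1 + h and T3 = T1 + 2 h supply the powers U and U^2. *)
have : {ae Q, forall w, 0 < X w -> expR (V w * h) = expR (sigma ^+ 2 * h)}.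
  have mS := measF S t hS t0; have mtheta := measF theta t htheta t0.
  have mV : measurable_fun setT V by exact: measurable_funX.
  apply: (ae_eq_of_geometric_moments _ _ _ _ _ _
      (pos_part z0 ^+ 2 / 2 * expR (sigma ^+ 2 * T1))).
  - apply: measurable_funM.
      by apply: measurable_funM => //; apply: measurable_funX;
        exact: measurable_pos_part.
    by apply: measurableT_comp => //; exact: measurable_funM.
  - by apply: measurableT_comp => //; exact: measurable_funM.
  - by move=> w; rewrite mulr_ge0 ?expR_ge0// divr_ge0// sqr_ge0.
  - by move=> w; exact: expR_ge0.
  - exact: expR_ge0.
  - by rewrite moment// !inE eqxx.
  - rewrite -mulrA -expRD (_ : _ + _ = sigma ^+ 2 * T2); last first.
      by rewrite /h; ring.
    rewrite -moment ?inE ?eqxx ?orbT//; apply: eq_integral => w _.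
    by rewrite /X -mulrA -expRD; congr (_ * expR _)%:E; rewrite /h; ring.
  - rewrite -expRM_natl -mulrA -expRD (_ : _ + _ = sigma ^+ 2 * T3); last first.
      by rewrite (_ : T3 = T1 + 2 * h) /h; [ring|lra].
    rewrite -moment ?inE ?eqxx ?orbT//; apply: eq_integral => w _.
    rewrite /X -expRM_natl -mulrA -expRD; congr (_ * expR _)%:E.
    by rewrite (_ : T3 = T1 + 2 * h) /h; [ring|lra].
apply: filterS2 (hSpos t t0) => w St0 /(_ _)/expR_inj.
have X0 : 0 < X w.
  rewrite mulr_gt0 ?expR_gt0// divr_gt0// exprn_gt0//.
  by rewrite /pos_part lt_max St0.
by move=> /(_ X0)/mulIf; apply; rewrite subr_eq0 gt_eqF.
Qed.
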